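(* Let $G=A_5\simeq\mathrm{PSL}_2(\mathbb{F}_4)$ and $H\simeq V_4$. There is a flabby resolution $0\to J_{G/H}\to P\to F\to0$ with $\mathrm{rank}_{\mathbb{Z}}F=21$ such that there is an isomorphism of $A_5$-lattices $$\mathbb{Z}[A_5/C_5]\oplus\mathbb{Z}[A_5/A_4]^{\oplus2}\simeq\mathbb{Z}\oplus F$$ (rank $22$). In particular $F$ is stably permutation.
   Context: A $G$-lattice is a finitely generated $\mathbb{Z}[G]$-module free over $\mathbb{Z}$. A permutation $G$-lattice is one isomorphic to $\bigoplus_i\mathbb{Z}[G/H_i]$; $\mathbb{Z}$ is the trivial lattice. Stably permutation: $M\oplus P\simeq P'$ with $P,P'$ permutation. $F$ is flabby if $\widehat H^{-1}(H',F)=0$ for all subgroups $H'\le G$. A flabby resolution of $M$ is an exact sequence $0\to M\to P\to F\to0$ with $P$ permutation and $F$ flabby. For $H\le G$, the Chevalley module $J_{G/H}=\mathrm{Hom}_{\mathbb{Z}}(I_{G/H},\mathbb{Z})$ where $I_{G/H}=\ker(\mathbb{Z}[G/H]\to\mathbb{Z})$; $0\to\mathbb{Z}\to\mathbb{Z}[G/H]\to J_{G/H}\to0$ is exact. $V_4=C_2\times C_2$. Subgroups $C_5$, $A_4$ of $A_5$ are unique up to conjugacy. *)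

(* Defs.v *)
From HB Require Import structures.
From mathcomp Require Import all_boot all_order all_algebra all_fingroup all_solvable.
From mathcomp Require Import mxrepresentation.
Set Implicit Arguments. Unset Strict Implicit. Unset Printing Implicit Defensive.
Import GRing.Theory.
Local Open Scope ring_scope.

Definition A5 : {group {perm 'I_5}} := [group of @Alt 'I_5].
Definition A4 : {group {perm 'I_4}} := [group of @Alt 'I_4].
Definition V4 : {group ('Z_2 * 'Z_2)%type} := [set: ('Z_2 * 'Z_2)%type]%G.
Definition C5 : {group 'Z_5} := [set: 'Z_5]%G.

Section Lattices.
Variable gT : finGroupType.
Implicit Types G H : {group gT}.

(* A G-lattice of rank n: Z^n (row vectors) with a representation
   r : G -> GL_n(Z), acting on the right: v |-> v *m r x. *)
Definition is_lattice G n (r : gT -> 'M[int]_n) : Prop := mx_repr G r.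

Definition is_hom G m n (r1 : gT -> 'M[int]_m) (r2 : gT -> 'M[int]_n)
    (f : 'M[int]_(m, n)) : Prop :=
  forall x, x \in G -> r1 x *m f = f *m r2 x.

Definition lattice_iso G m n (r1 : gT -> 'M[int]_m) (r2 : gT -> 'M[int]_n) : Prop :=
  exists (f : 'M[int]_(m, n)) (g : 'M[int]_(n, m)),
    [/\ is_hom G r1 r2 f, f *m g = 1%:M & g *m f = 1%:M].

Definition dsum m n (r1 : gT -> 'M[int]_m) (r2 : gT -> 'M[int]_n) :
    gT -> 'M[int]_(m + n) :=
  fun x => block_mx (r1 x) 0 0 (r2 x).

Definition triv_lat : gT -> 'M[int]_1 := fun _ => 1%:M.

Definition coset_nth G H (i : nat) : {set gT} := nth set0 (enum (rcosets H G)) i.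

Definition perm_lat G H : gT -> 'M[int]_(#|rcosets H G|) :=
  fun x => \matrix_(i, j) ((coset_nth G H i :* x == coset_nth G H j)%g%:R).

(* Augmentation ideal I_{G/H} = ker(Z[G/H] -> Z), in the Z-basis
   b_k = e_k - e_N (k < N), where N = #|G:H| - 1. *)
Definition aug_lat G H : gT -> 'M[int]_(#|rcosets H G|.-1) :=
  fun x => \matrix_(i, j)
    ((coset_nth G H i :* x == coset_nth G H j)%g%:R
     - (coset_nth G H #|rcosets H G|.-1 :* x == coset_nth G H j)%g%:R).

Definition dual_lat n (r : gT -> 'M[int]_n) : gT -> 'M[int]_n :=
  fun x => (r x^-1%g)^T.

Definition chevalley_lat G H := dual_lat (aug_lat G H).

Inductive perm_sum G : forall n, (gT -> 'M[int]_n) -> Prop :=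
  | perm_sum0 : perm_sum G (fun _ => (1%:M : 'M[int]_0))
  | perm_sumS (H : {group gT}) n (r : gT -> 'M[int]_n) :
      H \subset G -> perm_sum G r -> perm_sum G (dsum (perm_lat G H) r).

Definition is_permutation G n (r : gT -> 'M[int]_n) : Prop :=
  exists p (r' : gT -> 'M[int]_p), perm_sum G r' /\ lattice_iso G r r'.

Definition stably_permutation G n (r : gT -> 'M[int]_n) : Prop :=
  exists p (rP : gT -> 'M[int]_p) q (rQ : gT -> 'M[int]_q),
    [/\ is_permutation G rP, is_permutation G rQ & lattice_iso G (dsum r rP) rQ].

(* Tate cohomology: \hat H^{-1}(K, M) = {v | N_K v = 0} / I_K M vanishes. *)
Definition tate_m1_vanishes (K : {group gT}) n (r : gT -> 'M[int]_n) : Prop :=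
  forall v : 'rV[int]_n, v *m (\sum_(h in K) r h) = 0 ->
    exists w : gT -> 'rV[int]_n, v = \sum_(h in K) w h *m (r h - 1%:M).

Definition flabby G n (r : gT -> 'M[int]_n) : Prop :=
  forall K : {group gT}, K \subset G -> tate_m1_vanishes K r.

Definition short_exact G m p f (rM : gT -> 'M[int]_m) (rP : gT -> 'M[int]_p)
    (rF : gT -> 'M[int]_f) (i : 'M[int]_(m, p)) (pi : 'M[int]_(p, f)) : Prop :=
  [/\ is_hom G rM rP i, is_hom G rP rF pi,
      (forall u : 'rV[int]_m, u *m i = 0 -> u = 0),
      (forall w : 'rV[int]_f, exists v : 'rV[int]_p, v *m pi = w) &
      (forall v : 'rV[int]_p, v *m pi = 0 <-> exists u : 'rV[int]_m, v = u *m i)].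

Definition flabby_resolution G m p f (rM : gT -> 'M[int]_m) (rP : gT -> 'M[int]_p)
    (rF : gT -> 'M[int]_f) (i : 'M[int]_(m, p)) (pi : 'M[int]_(p, f)) : Prop :=
  [/\ is_lattice G rP, is_lattice G rF, short_exact G rM rP rF i pi,
      is_permutation G rP & flabby G rF].

End Lattices.

(* Main.v *)
(* Realise the transitive A5-sets as conjugacy classes under conjugation:
   A5/V4 = involutions, A5/C3 = 3-cycles, A5/C5 = the class of a 5-cycle, and
   A5/A4 = the five points. Take P = Z[A5/C3] + Z[A5/V4] and
   Q = Z[A5/C5] + Z[A5/A4]^2. Two explicit A5-maps T : Z[A5/V4] -> P, vanishing
   on the norm element, and pi : P -> Q make

       0 -> Z -> Z[A5/V4] -T-> P -pi-> Q -phi-> Z -> 0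

   exact, where phi is 1, -3, -4 on the basis vectors of the three summands of
   Q. The invariant vector z = (3, 1, 1) satisfies
   phi(z) = 3 * 12 - 3 * 5 - 4 * 5 = 1, so Q = Z + F with F = ker phi. Hence F is
   a direct summand of a permutation lattice, which makes it flabby, and
   0 -> J -> P -> F -> 0 is the required resolution. Exactness over Z is certified
   by explicit integral splittings, checked by computation. *)
Require Import Defs.
From HB Require Import structures.
From mathcomp Require Import all_boot all_order all_algebra all_fingroup all_solvable.
From mathcomp Require Import mxrepresentation.

Set Implicit Arguments. Unset Strict Implicit. Unset Printing Implicit Defensive.
Import GRing.Theory Num.Theory.
Local Open Scope ring_scope.

(** * Morphisms of lattices *)

Section LatticeMorphisms.
Variables (gT : finGroupType) (G : {group gT}).

Lemma lattice_iso_sym m n (r1 : gT -> 'M[int]_m) (r2 : gT -> 'M[int]_n) :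
  lattice_iso G r1 r2 -> lattice_iso G r2 r1.
Proof.
case=> f [g [hf fg gf]]; exists g, f; split=> // x xG.
by rewrite -[r2 x]mul1mx -gf -(mulmxA g) -hf // -!mulmxA fg mulmx1.
Qed.

Lemma lattice_iso_refl n (r : gT -> 'M[int]_n) : lattice_iso G r r.
Proof. by exists 1%:M, 1%:M; split=> [x _||]; rewrite ?mulmx1 ?mul1mx. Qed.

Lemma lattice_iso_trans m n p (r1 : gT -> 'M[int]_m) (r2 : gT -> 'M[int]_n)
    (r3 : gT -> 'M[int]_p) :
  lattice_iso G r1 r2 -> lattice_iso G r2 r3 -> lattice_iso G r1 r3.
Proof.
move=> [f [f' [hf ff' f'f]]] [g [g' [hg gg' g'g]]].
exists (f *m g), (g' *m f'); split=> [x xG||].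
- by rewrite mulmxA hf // -mulmxA hg // mulmxA.
- by rewrite -mulmxA (mulmxA g) gg' mul1mx.
- by rewrite -mulmxA (mulmxA f') f'f mul1mx.
Qed.

Lemma is_hom_dsum m1 n1 m2 n2 (r1 : gT -> 'M[int]_m1) (s1 : gT -> 'M[int]_n1)
    (r2 : gT -> 'M[int]_m2) (s2 : gT -> 'M[int]_n2) f g :
  is_hom G r1 s1 f -> is_hom G r2 s2 g ->
  is_hom G (dsum r1 r2) (dsum s1 s2) (block_mx f 0 0 g).
Proof.
move=> hf hg x xG; rewrite /dsum !mulmx_block !mulmx0 !mul0mx !addr0 !add0r.
by rewrite hf ?hg.
Qed.

Lemma lattice_iso_dsum m1 n1 m2 n2 (r1 : gT -> 'M[int]_m1)
    (s1 : gT -> 'M[int]_n1) (r2 : gT -> 'M[int]_m2) (s2 : gT -> 'M[int]_n2) :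
  lattice_iso G r1 s1 -> lattice_iso G r2 s2 ->
  lattice_iso G (dsum r1 r2) (dsum s1 s2).
Proof.
move=> [f [f' [hf ff' f'f]]] [g [g' [hg gg' g'g]]].
exists (block_mx f 0 0 g), (block_mx f' 0 0 g'); split.
- exact: is_hom_dsum.
- rewrite mulmx_block !mulmx0 !mul0mx !addr0 !add0r ff' gg'.
  by rewrite -scalar_mx_block.
- rewrite mulmx_block !mulmx0 !mul0mx !addr0 !add0r f'f g'g.
  by rewrite -scalar_mx_block.
Qed.

Lemma lattice_iso_dsumC m n (r : gT -> 'M[int]_m) (s : gT -> 'M[int]_n) :
  lattice_iso G (dsum r s) (dsum s r).
Proof.
exists (block_mx 0 1%:M 1%:M 0), (block_mx 0 1%:M 1%:M 0); split=> [x _||].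
- by rewrite /dsum !mulmx_block !mulmx0 !mul0mx !mulmx1 !mul1mx !addr0 !add0r.
- rewrite !mulmx_block !mulmx0 !mul0mx !mulmx1 !addr0 !add0r.
  by rewrite -scalar_mx_block.
- rewrite !mulmx_block !mulmx0 !mul0mx !mulmx1 !addr0 !add0r.
  by rewrite -scalar_mx_block.
Qed.

Lemma lattice_iso_dsum0 n (r : gT -> 'M[int]_n) :
  lattice_iso G r (dsum r (fun _ => (1%:M : 'M[int]_0))).
Proof.
exists (row_mx 1%:M 0), (col_mx 1%:M 0); split=> [x _||].
- by rewrite /dsum mul_row_block mul_mx_row !mulmx0 !mul0mx !addr0 mulmx1 mul1mx.
- by rewrite mul_row_col mulmx1 mul0mx addr0.
- rewrite mul_col_row !mulmx0 mul0mx mulmx1 scalar_mx_block.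
  by congr block_mx; apply/matrixP=> [] [].
Qed.

Lemma dsum_repr m n (r : gT -> 'M[int]_m) (s : gT -> 'M[int]_n) :
  mx_repr G r -> mx_repr G s -> mx_repr G (dsum r s).
Proof.
move=> [r1 rM] [s1 sM]; split=> [|x y xG yG]; rewrite /dsum.
  by rewrite r1 s1 -scalar_mx_block.
by rewrite mulmx_block !mulmx0 !mul0mx !addr0 !add0r rM ?sM.
Qed.

(** The elements of [G] that commute with [f] form a subgroup, so generators suffice. This reduces
    equivariance under A5 to two matrix identities. *)
Lemma is_hom_gen (A : {set gT}) m n (r : gT -> 'M[int]_m)
    (s : gT -> 'M[int]_n) f :
  G :=: <<A>>%g -> mx_repr G r -> mx_repr G s ->
  (forall x, x \in A -> r x *m f = f *m s x) -> is_hom G r s f.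
Proof.
move=> defG [r1 rM] [s1 sM] hA.
pose K := [set x in G | r x *m f == f *m s x].
have gK : group_set K.
  apply/group_setP; split=> [|x y].
    by rewrite inE group1 r1 s1 mul1mx mulmx1 eqxx.
  rewrite !inE => /andP[xG /eqP hx] /andP[yG /eqP hy].
  by rewrite groupM // rM // sM // -mulmxA hy mulmxA hx mulmxA eqxx.
move=> x xG; suff /subsetP/(_ x xG) : G \subset group gK.
  by rewrite inE => /andP[_ /eqP].
rewrite defG gen_subG; apply/subsetP=> y yA.
by rewrite inE hA // eqxx andbT defG mem_gen.
Qed.

Lemma is_permutation_dsum (H : {group gT}) n (r : gT -> 'M[int]_n) :
  H \subset G -> is_permutation G r -> is_permutation G (dsum (perm_lat G H) r).
Proof.
move=> HG [p [r' [sr' rr']]]; exists _, (dsum (perm_lat G H) r'); split.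
  by constructor.
exact: lattice_iso_dsum (lattice_iso_refl _) rr'.
Qed.

Lemma is_permutation_perm_lat (H : {group gT}) :
  H \subset G -> is_permutation G (perm_lat G H).
Proof.
move=> HG; exists _, (dsum (perm_lat G H) (fun _ => (1%:M : 'M[int]_0))).
split; last exact: lattice_iso_dsum0.
by constructor=> //; constructor.
Qed.

Lemma is_permutation_iso m n (r : gT -> 'M[int]_m) (s : gT -> 'M[int]_n) :
  lattice_iso G r s -> is_permutation G s -> is_permutation G r.
Proof.
move=> rs [p [r' [sr' ss']]]; exists p, r'; split=> //.
exact: lattice_iso_trans rs ss'.
Qed.

Lemma tate_dsum (K : {group gT}) m n (r : gT -> 'M[int]_m)
    (s : gT -> 'M[int]_n) :
  tate_m1_vanishes K r -> tate_m1_vanishes K s -> tate_m1_vanishes K (dsum r s).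
Proof.
move=> hr hs v; rewrite -[v]hsubmxK.
have -> : \sum_(h in K) dsum r s h =
    block_mx (\sum_(h in K) r h) 0 0 (\sum_(h in K) s h).
  elim/big_rec3: _ => [|h A B C _ ->].
    by rewrite [LHS](_ : _ = block_mx 0 0 0 0) // block_mx0.
  by rewrite /dsum add_block_mx !addr0.
rewrite mul_row_block !mulmx0 addr0 add0r -row_mx0 => /eq_row_mx[/hr[u hu] /hs[w hw]].
exists (fun h => row_mx (u h) (w h)); rewrite {1}hu {1}hw.
elim/big_rec3: _ => [|h A B C _ <-]; first by rewrite row_mx0.
rewrite /dsum scalar_mx_block opp_block_mx add_block_mx !subr0 mul_row_block.
by rewrite !mulmx0 addr0 add0r add_row_mx.
Qed.

(** Flabbiness passes to direct summands: push [v] into [s] along [a], where the norm still kills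
    it, then carry the coefficients found there back along [b]. *)
Lemma tate_summand (K : {group gT}) m n (r : gT -> 'M[int]_m)
    (s : gT -> 'M[int]_n) (a : 'M[int]_(m, n)) (b : 'M[int]_(n, m)) :
  is_hom K r s a -> is_hom K s r b -> a *m b = 1%:M ->
  tate_m1_vanishes K s -> tate_m1_vanishes K r.
Proof.
move=> ha hb ab hs v hv; have [|w hw] := hs (v *m a).
  rewrite -mulmxA mulmx_sumr.
  rewrite (eq_bigr (fun h => r h *m a)) => [|h hK]; last by rewrite ha.
  by rewrite -mulmx_suml mulmxA hv mul0mx.
exists (fun h => w h *m b).
have -> : v = v *m a *m b by rewrite -mulmxA ab mulmx1.
rewrite hw mulmx_suml; apply: eq_bigr => h hK.
rewrite -!mulmxA; congr (_ *m _).
by rewrite mulmxBl mulmxBr mul1mx mulmx1 hb.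
Qed.

End LatticeMorphisms.

(** * Permutation lattices of transitive sets *)

Section OrbitLattices.
Variable gT : finGroupType.

(** An explicit list fixes the order of the basis, which makes the matrices computable; in
    [perm_lat] the order comes from the enumeration of a set of cosets. *)
Definition seq_lat (X : eqType) (to : X -> gT -> X) x0 (p : seq X) n :
    gT -> 'M[int]_n :=
  fun x => \matrix_(i, j) (to (nth x0 p i) x == nth x0 p j)%:R.

Lemma sum_nth (X : eqType) (x0 : X) (p : seq X) n a (h : X -> int) :
  uniq p -> size p = n -> a \in p ->
  \sum_(k < n) (a == nth x0 p k)%:R * h (nth x0 p k) = h a.
Proof.
move=> Up sp ap; have lt_an : (index a p < n)%N by rewrite -sp index_mem.
rewrite (bigD1 (Ordinal lt_an)) //= nth_index // eqxx mul1r big1 ?addr0 // => k.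
rewrite -val_eqE /= => nk; case: eqP => [ak|]; last by rewrite mul0r.
by move: nk; rewrite ak index_uniq ?eqxx // sp.
Qed.

Section Relabel.
Variables (G : {group gT}) (X Y : eqType) (toX : X -> gT -> X) (toY : Y -> gT -> Y).
Variables (x0 : X) (y0 : Y) (p : seq X) (q : seq Y) (n m : nat) (phi : X -> Y).
Hypotheses (Up : uniq p) (sp : size p = m) (sq : size q = n).
Hypothesis pG : forall a x, a \in p -> x \in G -> toX a x \in p.
Hypothesis phiG :
  forall a x, a \in p -> x \in G -> phi (toX a x) = toY (phi a) x.
Hypothesis Uphi : {in p &, injective phi}.
Hypothesis defq : map phi p =i q.
Hypothesis Uq : uniq q.

Definition relabel_mx : 'M[int]_(m, n) :=
  \matrix_(i, j) (phi (nth x0 p i) == nth y0 q j)%:R.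

Let memp (i : 'I_m) : nth x0 p i \in p. Proof. by rewrite mem_nth ?sp. Qed.
Let memq (i : 'I_n) : nth y0 q i \in q. Proof. by rewrite mem_nth ?sq. Qed.
Let phiq a : a \in p -> phi a \in q.
Proof. by move=> ap; rewrite -defq map_f. Qed.

Lemma relabel_mxK : relabel_mx *m relabel_mx^T = 1%:M.
Proof.
apply/matrixP=> i j; rewrite !mxE.
under eq_bigr => k _ do rewrite !mxE.
rewrite (sum_nth y0 (fun y => (phi (nth x0 p j) == y)%:R) Uq sq) ?phiq //.
rewrite (inj_in_eq Uphi) // nth_uniq ?sp // eq_sym.
by rewrite val_eqE.
Qed.

Lemma relabel_mxVK : relabel_mx^T *m relabel_mx = 1%:M.
Proof.
apply/matrixP=> i j; rewrite !mxE.
have := memq i; rewrite -defq => /mapP[a ap ea].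
under eq_bigr => k _ do rewrite !mxE ea eq_sym (inj_in_eq Uphi) //.
rewrite (sum_nth x0 (fun x => (phi x == nth y0 q j)%:R) Up sp) //.
by rewrite -ea nth_uniq ?sq // val_eqE.
Qed.

Lemma relabel_mx_hom :
  is_hom G (seq_lat toX x0 p m) (seq_lat toY y0 q n) relabel_mx.
Proof.
move=> x xG; apply/matrixP=> i j; rewrite !mxE.
under eq_bigr => k _ do rewrite !mxE.
rewrite (sum_nth x0 (fun a => (phi a == nth y0 q j)%:R) Up sp) ?pG //.
under [RHS]eq_bigr => k _ do rewrite !mxE.
by rewrite (sum_nth y0 (fun a => (toY a x == nth y0 q j)%:R) Uq sq) ?phiq // phiG.
Qed.

(** The norm element must be preserved, because J is the quotient of Z[G/H] by it. *)
Lemma ones_relabel_mx :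
  const_mx 1 *m relabel_mx = const_mx 1 :> 'rV_n.
Proof.
apply/rowP=> j; rewrite !mxE.
have := memq j; rewrite -defq => /mapP[a ap ea].
under eq_bigr => k _.
  rewrite !mxE ea (inj_in_eq Uphi) // eq_sym mulrC; over.
by rewrite (sum_nth x0 (fun=> 1) Up sp).
Qed.

End Relabel.

Section Orbit.
Variables (G : {group gT}) (X : finType) (to : {action gT &-> X}) (x0 : X).

Definition orbit_seq (p : seq X) n :=
  [/\ uniq p, size p = n & forall x, x \in p -> orbit to G x =i p].

Variables (p : seq X) (n : nat).
Hypothesis pG : orbit_seq p n.

Lemma orbit_seq_act a x : a \in p -> x \in G -> to a x \in p.
Proof. by case: pG => _ _ pO ap xG; rewrite -(pO a ap) mem_orbit. Qed.

Lemma seq_lat_repr : mx_repr G (seq_lat to x0 p n).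
Proof.
case: (pG) => Up sp _; split=> [|x y xG yG].
  by apply/matrixP=> i j; rewrite !mxE act1 nth_uniq ?sp // val_eqE.
apply/matrixP=> i j; rewrite !mxE.
under eq_bigr => k _ do rewrite !mxE.
rewrite (sum_nth x0 (fun a => (to a y == nth x0 p j)%:R) Up sp).
  by rewrite actM.
by rewrite orbit_seq_act // mem_nth ?sp.
Qed.

(* The relabelling sends a coset K g of the stabiliser K of x to the point x g. *)
Lemma perm_lat_orbit (K : {group gT}) x :
  x \in p -> K \subset G -> (forall k, k \in K -> to x k = x) ->
  (#|K| * n = #|G|)%N ->
  exists (f : 'M[int]_(#|rcosets K G|, n)) (g : 'M[int]_(n, #|rcosets K G|)),
    [/\ is_hom G (perm_lat G K) (seq_lat to x0 p n) f, f *m g = 1%:M,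
        g *m f = 1%:M & const_mx 1 *m f = const_mx 1 :> 'rV_n].
Proof.
move=> xp KG xK cK; case: (pG) => Up sp pO.
(* As [n] is the length of the orbit of [x], the order condition forces [K] to be the full
   stabiliser of [x]. *)
have idx : #|rcosets K G| = n.
  by apply/eqP; rewrite -(eqn_pmul2l (cardG_gt0 K)) Lagrange ?cK.
pose phi (B : {set gT}) := to x (repr B).
have phiE g : phi (K :* g)%g = to x g.
  rewrite /phi; have /rcosetP[k kK ->] := mem_repr_rcoset K g.
  by rewrite actM xK.
have phip : map phi (enum (rcosets K G)) =i p.
  move=> y; rewrite -(pO x xp); apply/mapP/orbitP => [[B]|[g gG <-]].
    by rewrite mem_enum => /rcosetsP[g gG ->] ->; exists g.
  by exists (K :* g)%g; rewrite ?phiE // mem_enum; apply/rcosetsP; exists g.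
have sq : size (enum (rcosets K G)) = #|rcosets K G| by rewrite -cardE.
(* Injectivity by counting: [phi] is onto [p], and both lists have [n] entries. *)
have Uphi : {in enum (rcosets K G) &, injective phi}.
  have /dinjectiveP inj : uniq (map phi (enum (rcosets K G))).
    apply: leq_size_uniq Up _ _ => [y|]; first by rewrite phip.
    by rewrite size_map sq idx sp.
  by move=> A B; rewrite !mem_enum; apply: inj.
have Ue := enum_uniq (rcosets K G).
have stab a z : a \in enum (rcosets K G) -> z \in G ->
    (a :* z)%g \in enum (rcosets K G) /\ phi (a :* z)%g = to (phi a) z.
  rewrite !mem_enum => /rcosetsP[g gG ->] zG; rewrite -rcosetM !phiE actM.
  by split=> //; apply/rcosetsP; exists (g * z)%g; rewrite ?groupM.
exists (relabel_mx set0 x0 (enum (rcosets K G)) p n #|rcosets K G| phi).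
exists (relabel_mx set0 x0 (enum (rcosets K G)) p n #|rcosets K G| phi)^T.
split.
- have := @relabel_mx_hom G _ _ (fun A z => A :* z)%g to set0 x0
    (enum (rcosets K G)) p n _ phi Ue sq sp.
  by apply=> // a z ae zG; case: (stab a z).
- exact: relabel_mxK.
- exact: relabel_mxVK.
- exact: ones_relabel_mx.
Qed.

Lemma lattice_iso_orbit (K : {group gT}) x :
  x \in p -> K \subset G -> (forall k, k \in K -> to x k = x) ->
  (#|K| * n = #|G|)%N -> lattice_iso G (perm_lat G K) (seq_lat to x0 p n).
Proof.
move=> xp KG xK cK; have [f [g [hf fg gf _]]] := perm_lat_orbit xp KG xK cK.
by exists f, g.
Qed.

(** The orbit-stabiliser theorem supplies the order condition of [lattice_iso_orbit]. *)
Lemma lattice_iso_stab x :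
  x \in p -> lattice_iso G (perm_lat G 'C_G[x | to]) (seq_lat to x0 p n).
Proof.
move=> xp; apply: (lattice_iso_orbit xp); first exact: subsetIl.
  by move=> k /setIP[_ /astab1P].
case: pG => Up sp /(_ x xp) pO.
by rewrite mulnC -(card_orbit_stab to G x) (eq_card pO) (card_uniqP Up) sp.
Qed.

(* With E the projection of each point to a chosen representative of its
   K-orbit, N E = |K| E, so v N = 0 forces v E = 0 and v = v (1 - E). *)
Lemma seq_lat_tate (K : {group gT}) :
  K \subset G -> tate_m1_vanishes K (seq_lat to x0 p n).
Proof.
move=> KG v hv; case: (pG) => Up sp pO.
pose rho a := odflt a [pick b in orbit to K a].
have rhoP a : rho a \in orbit to K a.
  rewrite /rho; case: pickP => //= _; exact: orbit_refl.
(* The choice made by [pick] depends only on the orbit as a set, so [rho] is constant on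
   [K]-orbits. *)
have rhoE a k : k \in K -> rho (to a k) = rho a.
  move=> kK; have ea : orbit to K (to a k) = orbit to K a.
    by apply/orbit_eqP; rewrite mem_orbit.
  rewrite /rho ea; case: pickP => //= /(_ a).
  by rewrite orbit_refl.
have exh a : exists2 k, k \in K & to (rho a) k = a.
  by have := rhoP a; rewrite orbit_sym => /orbitP[k kK ka]; exists k.
pose k_ a := s2val (sig2_eqW (exh a)).
have kK a : k_ a \in K by exact: s2valP (sig2_eqW (exh a)).
have kE a : to (rho a) (k_ a) = a by exact: s2valP' (sig2_eqW (exh a)).
have memp (i : 'I_n) : nth x0 p i \in p by rewrite mem_nth ?sp.
have rhop a : a \in p -> rho a \in p.
  move=> ap; have /orbitP[k k_in <-] := rhoP a.
  by rewrite orbit_seq_act ?(subsetP KG).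
pose e a : 'rV[int]_n := \row_j (a == nth x0 p j)%:R.
have eM a x : a \in p -> x \in G -> e a *m seq_lat to x0 p n x = e (to a x).
  move=> ap xG; apply/rowP=> j; rewrite !mxE.
  under eq_bigr => k _ do rewrite !mxE.
  by rewrite (sum_nth x0 (fun a => (to a x == nth x0 p j)%:R) Up sp).
pose E : 'M[int]_n := \matrix_(i, j) e (rho (nth x0 p i)) 0 j.
have eE a : a \in p -> e a *m E = e (rho a).
  move=> ap; apply/rowP=> j; rewrite !mxE.
  under eq_bigr => k _ do rewrite !mxE.
  by rewrite (sum_nth x0 (fun a => (rho a == nth x0 p j)%:R) Up sp).
have ev (w : 'rV[int]_n) : w = \sum_i w 0 i *: e (nth x0 p i).
  rewrite {1}[w]row_sum_delta; apply: eq_bigr => i _; congr (_ *: _).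
  by apply/rowP=> j; rewrite !mxE nth_uniq ?sp // val_eqE eq_sym.
have vE0 : v *m E = 0.
  have : v *m (\sum_(h in K) seq_lat to x0 p n h) *m E = (v *m E) *+ #|K|.
    rewrite {1}(ev v) {2}(ev v) !mulmx_suml -sumrMnl; apply: eq_bigr => i _.
    rewrite -!scalemxAl eE // scalerMnr; congr (_ *: _).
    rewrite mulmx_sumr mulmx_suml (eq_bigr (fun=> e (rho (nth x0 p i)))).
      by rewrite sumr_const.
    move=> h hK; rewrite eM ?(subsetP KG) // eE ?rhoE //.
    by rewrite orbit_seq_act ?(subsetP KG).
  rewrite hv mul0mx => /esym/matrixP vE; apply/matrixP=> i j.
  move/(_ i j)/eqP: vE; rewrite mulmxnE [X in _ == X]mxE mulrn_eq0.
  by rewrite eqn0Ngt cardG_gt0 => /eqP->; rewrite mxE.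
(* For each point a, e(a) - e(rho a) = e(rho a)(k_a - 1). The witness collects these terms of v - v
   E according to the value h of k_a. *)
exists (fun h => \sum_(i < n | k_ (nth x0 p i) == h) v 0 i *: e (rho (nth x0 p i))).
under eq_bigr => h hK do rewrite mulmx_suml.
transitivity (v - v *m E); first by rewrite vE0 subr0.
rewrite {1 2}(ev v) mulmx_suml -sumrB.
rewrite (partition_big (fun i : 'I_n => k_ (nth x0 p i)) (mem K)) //=.
apply: eq_bigr => h hK; apply: eq_bigr => i /eqP <-.
rewrite -!scalemxAl -scalerBr; congr (_ *: _).
by rewrite mulmxBr mulmx1 eE // eM ?kE ?rhop // (subsetP KG).
Qed.

End Orbit.
End OrbitLattices.

(** * The Chevalley module *)

(** Entries indexed by natural numbers instead of ordinals can be evaluated, so matrix identities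
    become finite checks on functions. *)
Definition mxf m n (f : nat -> nat -> int) : 'M[int]_(m, n) :=
  \matrix_(i, j) f i j.

Lemma sum_pick n i (f : nat -> int) :
  (i < n)%N -> \sum_(k < n) (i == k)%:R * f k = f i.
Proof.
move=> lt_in; rewrite (bigD1 (Ordinal lt_in)) //= eqxx mul1r big1 ?addr0 // => k.
by rewrite -val_eqE /= eq_sym => /negbTE->; rewrite mul0r.
Qed.

Section Chevalley.
Variables (gT : finGroupType) (G H : {group gT}).
Local Notation N := #|rcosets H G|.

(* J = Z[G/H] / Z: [chev_proj] sends e_i to the restriction to I of its dual
   coordinate, and [chev_sect] lifts the basis dual to (b_k) back to e_k. *)
Definition chev_sect n := mxf n.-1 n (fun i j => (i == j)%:R).
Definition chev_proj n := mxf n n.-1 (fun i j => (i == j)%:R - (i == n.-1)%:R).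

Lemma chev_sectK n : chev_sect n *m chev_proj n = 1%:M.
Proof.
apply/matrixP=> i j; rewrite !mxE.
have lt_in : (i < n)%N by apply: leq_trans (ltn_ord i) (leq_pred n).
under eq_bigr => k _ do rewrite !mxE.
rewrite (sum_pick (fun k => (k == j :> nat)%:R - (k == n.-1)%:R) lt_in).
by rewrite (ltn_eqF (ltn_ord i)) subr0 val_eqE.
Qed.

Lemma ones_chev_proj n : const_mx 1 *m chev_proj n = 0 :> 'rV_n.-1.
Proof.
apply/rowP=> j; rewrite !mxE.
have lt_jn : (j < n)%N by apply: leq_trans (ltn_ord j) (leq_pred n).
have lt_n : (n.-1 < n)%N by rewrite ltn_predL (leq_trans _ lt_jn).
under eq_bigr => k _ do rewrite !mxE mul1r.
rewrite sumrB; apply/eqP; rewrite subr_eq0; apply/eqP.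
transitivity (1 : int); last apply/esym.
  under eq_bigr => k _ do rewrite eq_sym -[_%:R]mulr1.
  exact: (sum_pick (fun=> 1)).
under eq_bigr => k _ do rewrite eq_sym -[_%:R]mulr1.
exact: (sum_pick (fun=> 1)).
Qed.

(** The last basis vector projects to minus the sum of the dual basis, which lifts to that vector
    minus the norm element; the others are recovered exactly. The composite is thus the identity
    modulo the norm. *)
Lemma chev_projK n :
  chev_proj n *m chev_sect n =
  1%:M - (\col_i (i == n.-1 :> nat)%:R) *m const_mx 1.
Proof.
apply/matrixP=> i j; rewrite !mxE big_ord1 !mxE mulr1.
under eq_bigr => k _ do rewrite !mxE mulrC eq_sym.
have [lt_jn | le_nj] := ltnP j n.-1.
  by rewrite (sum_pick (fun k => (i == k :> nat)%:R - (i == n.-1 :> nat)%:R)).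
have jn : j = n.-1 :> nat.
  by apply/eqP; rewrite eqn_leq le_nj andbT -ltnS (ltn_predK (ltn_ord j)).
rewrite big1 => [|k _]; last by rewrite jn (gtn_eqF (ltn_ord k)) mul0r.
by rewrite -jn val_eqE subrr.
Qed.

(** Permutation lattices are self-dual: transposing the matrix of x^-1 gives back the matrix of x.
    The dual of the augmentation ideal is therefore a quotient of Z[G/H] itself. *)
Lemma chevalley_latE x :
  chevalley_lat G H x = chev_sect N *m perm_lat G H x *m chev_proj N.
Proof.
apply/matrixP=> i j; rewrite !mxE.
have lt_n : (N.-1 < N)%N.
  by rewrite ltn_predL (leq_trans _ (leq_pred _)) // (leq_trans _ (ltn_ord i)).
have lt_iN : (i < N)%N by apply: leq_trans (ltn_ord i) (leq_pred _).
have lt_jN : (j < N)%N by apply: leq_trans (ltn_ord j) (leq_pred _).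
pose F (k : nat) : int := ((coset_nth G H i :* x == coset_nth G H k)%g)%:R.
under eq_bigr => k _.
  rewrite !mxE (eq_bigr (fun l : 'I__ => (i == l :> nat)%:R *
    ((coset_nth G H l :* x == coset_nth G H k)%g)%:R)).
    rewrite (sum_pick (fun l =>
      ((coset_nth G H l :* x == coset_nth G H k)%g)%:R)) //.
    rewrite mulrC mulrBl [(_ == (j : nat))]eq_sym [(_ == N.-1)]eq_sym; over.
  by move=> l _; rewrite !mxE.
rewrite sumrB (sum_pick F) // (sum_pick F) // /F.
have mv A B : (A :* x^-1 == B)%g = (B :* x == A)%g.
  by apply/eqP/eqP => [<-|<-]; rewrite -rcosetM ?mulVg ?mulgV rcoset1.
by rewrite !mv.
Qed.

(** Since [T] kills the norm element, it factors through J. The maps [R] and [s] need only be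
    integral, not equivariant: [R] inverts [T] modulo the norm, [s] is a section of [pi], and R T +
    pi s = 1 gives exactness in the middle. *)
Lemma chevalley_short_exact n p q (r : gT -> 'M[int]_n) (rP : gT -> 'M[int]_p)
    (rF : gT -> 'M[int]_q) (f : 'M[int]_(N, n)) (g : 'M[int]_(n, N))
    (T : 'M[int]_(n, p)) (R : 'M[int]_(p, n)) (k : 'cV[int]_n)
    (pi : 'M[int]_(p, q)) (s : 'M[int]_(q, p)) :
  is_hom G (perm_lat G H) r f -> f *m g = 1%:M -> g *m f = 1%:M ->
  const_mx 1 *m f = const_mx 1 :> 'rV_n ->
  is_hom G r rP T -> const_mx 1 *m T = 0 :> 'rV_p ->
  T *m R = 1%:M - k *m const_mx 1 ->
  is_hom G rP rF pi -> T *m pi = 0 -> s *m pi = 1%:M ->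
  R *m T + pi *m s = 1%:M ->
  short_exact G (chevalley_lat G H) rP rF (chev_sect N *m f *m T) pi.
Proof.
move=> hf fg gf f1 hT T1 TR hpi Tpi spi RTs.
(* A map killing the norm element is recovered from its restriction to the lifts of the basis of
   J. *)
have PK m (A : 'M_(N, m)) : const_mx 1 *m A = 0 :> 'rV_m ->
    chev_proj N *m (chev_sect N *m A) = A.
  by move=> A0; rewrite mulmxA chev_projK mulmxBl mul1mx -mulmxA A0 mulmx0 subr0.
have f1T : const_mx 1 *m (f *m T) = 0 :> 'rV_p by rewrite mulmxA f1.
have g1 : const_mx 1 *m g = const_mx 1 :> 'rV_N.
  by rewrite -f1 -mulmxA fg mulmx1.
(* An integral retraction of the injection: the error term of T R is a multiple of the norm element,
   which [chev_proj] kills. *)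
have iK : chev_sect N *m f *m T *m (R *m g *m chev_proj N) = 1%:M.
  rewrite -!mulmxA (mulmxA T) TR mulmxBl mul1mx mulmxBr (mulmxA f) fg mul1mx.
  rewrite -(mulmxA k) (mulmxA (const_mx 1)) g1 ones_chev_proj !mulmx0 subr0.
  exact: chev_sectK.
split=> //.
- move=> x xG; rewrite chevalley_latE -!mulmxA (PK _ _ f1T).
  congr (_ *m _); rewrite (mulmxA _ f) hf // -!mulmxA; congr (_ *m _).
  exact: hT.
- by move=> u u0; rewrite -[u]mulmx1 -iK mulmxA u0 mul0mx.
- by move=> w; exists (w *m s); rewrite -mulmxA spi mulmx1.
- move=> v; split=> [v0 | [u ->]]; last by rewrite -!mulmxA Tpi !mulmx0.
  exists (v *m (R *m g *m chev_proj N)).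
  rewrite -!mulmxA (PK _ _ f1T) (mulmxA g) gf mul1mx.
  have : v *m (R *m T + pi *m s) = v by rewrite RTs mulmx1.
  by rewrite mulmxDr (mulmxA v pi) v0 mul0mx addr0.
Qed.

End Chevalley.

(** * Permutations as tables *)

Section Tables.
Variable n : nat.
Implicit Types (x y : {perm 'I_n.+1}) (t u : seq nat).

(** A table is the list of values of a permutation. The left factor acts first, as in the product of
    [{perm T}]. *)
Definition tcomp t u := [seq nth 0%N u i | i <- t].
Definition tinv t := [seq index i t | i <- iota 0 (size t)].
Definition tconj t u := tcomp (tinv u) (tcomp t u).

Definition tab x : seq nat := [seq val (x i) | i <- enum 'I_n.+1].
Definition untab t : {perm 'I_n.+1} :=
  odflt 1%g [pick x | tab x == t].

Lemma size_tab x : size (tab x) = n.+1.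
Proof. by rewrite size_map size_enum_ord. Qed.

Lemma nth_tab x (i : 'I_n.+1) : nth 0%N (tab x) i = x i.
Proof. by rewrite (nth_map i) ?size_enum_ord // nth_ord_enum. Qed.

Lemma tab_inj : injective tab.
Proof.
by move=> x y xy; apply/permP=> i; apply: val_inj; rewrite /= -!nth_tab xy.
Qed.

Lemma tab1 : tab 1 = iota 0 n.+1.
Proof.
by rewrite -val_enum_ord; apply: eq_map => i; rewrite perm1.
Qed.

Lemma tabM x y : tab (x * y)%g = tcomp (tab x) (tab y).
Proof. by rewrite /tcomp -map_comp; apply: eq_map => i; rewrite /= permM nth_tab. Qed.

Lemma tab_uniq x : uniq (tab x).
Proof.
by rewrite map_inj_uniq ?enum_uniq // => i j /val_inj; apply: perm_inj.
Qed.

Lemma tabV x : tab x^-1%g = tinv (tab x).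
Proof.
rewrite /tinv size_tab -val_enum_ord -map_comp; apply: eq_map => i /=.
have := nth_tab x ((x^-1)%g i); rewrite permKV => <-.
by rewrite index_uniq ?tab_uniq ?size_tab.
Qed.

Lemma tabJ x y : tab (x ^ y)%g = tconj (tab x) (tab y).
Proof. by rewrite conjgE !tabM tabV. Qed.

Lemma tab_perm x : perm_eq (tab x) (iota 0 n.+1).
Proof.
apply: uniq_perm (tab_uniq x) (iota_uniq _ _) _ => i; rewrite mem_iota /=.
apply/mapP/idP=> [[j _ ->] | lt_in]; first exact: ltn_ord.
by exists ((x^-1)%g (Ordinal lt_in)); rewrite ?mem_enum ?permKV.
Qed.

Lemma tabK x : untab (tab x) = x.
Proof.
rewrite /untab; case: pickP => [y /eqP/tab_inj //|/(_ x)].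
by rewrite eqxx.
Qed.

Lemma untabK t : t \in permutations (iota 0 n.+1) -> tab (untab t) = t.
Proof.
rewrite mem_permutations => pt.
have szt : size t = n.+1 by rewrite (perm_size pt) size_iota.
have tlt i : (nth 0%N t i < n.+1)%N.
  have [le_t|lt_t] := leqP (size t) i; first by rewrite nth_default.
  by have := mem_nth 0%N lt_t; rewrite (perm_mem pt) mem_iota.
have f_inj : injective (fun i : 'I_n.+1 => Ordinal (tlt i)).
  move=> i j /(congr1 val) /= /eqP.
  by rewrite nth_uniq ?szt ?(perm_uniq pt) ?iota_uniq // => /eqP/val_inj.
have tx : tab (perm f_inj) = t.
  apply: (@eq_from_nth _ 0%N); rewrite size_tab // => i lt_i.
  by rewrite (nth_tab _ (Ordinal lt_i)) permE.
by rewrite -{1}tx tabK tx.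
Qed.

Lemma mem_tab x : tab x \in permutations (iota 0 n.+1).
Proof. by rewrite mem_permutations tab_perm. Qed.

(** A square is even, so an explicit square root certifies membership in the alternating group
    without computing a sign. *)
Lemma untab_sqr_even t u :
  t \in permutations (iota 0 n.+1) -> u \in permutations (iota 0 n.+1) ->
  tcomp u u = t -> untab t \in Alt 'I_n.+1.
Proof.
move=> tP uP ut; have -> : untab t = (untab u * untab u)%g.
  by apply: tab_inj; rewrite tabM !untabK.
by rewrite Alt_even odd_permM addbb.
Qed.

End Tables.

(** * The sixty elements of A5 as tables *)

Local Notation untab5 := (@untab 4).
Local Notation S5 := (permutations (iota 0 5)).

Definition tab5 := [:: 1; 2; 3; 4; 0]%N.
Definition tab3 := [:: 1; 2; 0; 3; 4]%N.
Definition tab22 := [:: 1; 0; 3; 2; 4]%N.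

Definition alt_step (l : seq (seq nat)) :=
  undup (l ++ [seq tcomp u tab5 | u <- l] ++ [seq tcomp u tab3 | u <- l]).
(** Eight rounds of right multiplication by the two generators reach all 60 elements. *)
Definition alt5 := Eval vm_compute in iter 8 alt_step [:: iota 0 5].

Definition tclass t := undup [seq tconj t u | u <- alt5].
Definition class15 := Eval vm_compute in tclass tab22.
Definition class20 := Eval vm_compute in tclass tab3.
(** The 24 five-cycles form two classes of 12 in A5; this is the class of [tab5]. *)
Definition class12 := Eval vm_compute in tclass tab5.


Lemma tab5_A5 : untab5 tab5 \in A5.
(* The square root of a 5-cycle c is c^3, since c^6 = c; for the 3-cycle below it is the inverse. *)
Proof. by apply: (@untab_sqr_even _ _ [:: 3; 4; 0; 1; 2]%N); vm_compute. Qed.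

Lemma tab3_A5 : untab5 tab3 \in A5.
Proof. by apply: (@untab_sqr_even _ _ [:: 2; 0; 1; 3; 4]%N); vm_compute. Qed.

Local Notation gens := [set untab5 tab5; untab5 tab3].

Lemma alt5_perm t : t \in alt5 -> t \in S5.
Proof. by apply/allP: t; vm_compute. Qed.

Lemma alt5_gen t : t \in alt5 -> untab5 t \in <<gens>>%g.
Proof.
have gs : untab5 tab5 \in <<gens>>%g by rewrite mem_gen ?set21.
have gt : untab5 tab3 \in <<gens>>%g by rewrite mem_gen ?set22.
have S5M u v : u \in S5 -> v \in S5 -> tcomp u v \in S5 /\
    untab5 (tcomp u v) = (untab5 u * untab5 v)%g.
  move=> uP vP; rewrite -[u](untabK uP) -[v](untabK vP) -tabM mem_tab.
  by rewrite !tabK.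
pose good (l : seq (seq nat)) := forall u, u \in l -> u \in S5 /\ untab5 u \in <<gens>>%g.
have step l : good l -> good (alt_step l).
  move=> lG u; rewrite mem_undup !mem_cat => /or3P[/lG //|/mapP[v]|/mapP[v]].
    move=> /lG[vP vg] ->; have [||wP ->] := S5M v tab5 => //.
    by rewrite groupM.
  move=> /lG[vP vg] ->; have [||wP ->] := S5M v tab3 => //.
  by rewrite groupM.
suff /(_ t) : good alt5 by move=> h /h[].
have -> : alt5 = iter 8 alt_step [:: iota 0 5] by vm_compute.
elim: 8%N => [|k IHk]; last exact: step.
by move=> u; rewrite inE => /eqP->; split; [by vm_compute | rewrite -(tab1 4) tabK group1].
Qed.

Lemma card_A5 : #|A5| = 60.
Proof.
have := @card_Alt 'I_5; rewrite card_ord => /(_ isT) h.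
by apply/eqP; rewrite -(eqn_pmul2l (isT : 0 < 2)%N) [(2 * _)%N]h.
Qed.

Lemma alt5_uniq : uniq (map untab5 alt5).
Proof.
rewrite map_inj_in_uniq; first by vm_compute.
by move=> t u /alt5_perm tP /alt5_perm uP tu; rewrite -(untabK tP) tu untabK.
Qed.

(** The generated subgroup lies in A5 and contains the 60 distinct permutations listed in [alt5], so
    the orders agree. *)
Lemma A5_gen : A5 :=: <<gens>>%g.
Proof.
apply/eqP; rewrite eq_sym eqEcard gen_subG card_A5; apply/andP; split.
  by apply/subsetP=> x /set2P[]->; rewrite ?tab5_A5 ?tab3_A5.
have <- : #|map untab5 alt5| = 60 by rewrite (card_uniqP alt5_uniq) size_map.
by apply/subset_leq_card/subsetP=> _ /mapP[t tL ->]; apply: (alt5_gen tL).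
Qed.

Lemma alt5_A5 t : t \in alt5 -> untab5 t \in A5.
Proof. by rewrite A5_gen => /alt5_gen. Qed.

(** By counting, the list exhausts A5; a check over [alt5] is thereby a proof for every element. *)
Lemma A5_tab x : x \in A5 -> tab x \in alt5.
Proof.
move=> xA.
have [_ eqA] : (size (map untab5 alt5) = size (enum A5)) *
    (map untab5 alt5 =i enum A5).
  apply: uniq_min_size alt5_uniq _ _ => [y /mapP[t tL ->]|].
    by rewrite mem_enum alt5_A5.
  by rewrite -cardE size_map card_A5.
have : x \in map untab5 alt5 by rewrite eqA mem_enum.
by case/mapP=> t tL ->; rewrite untabK ?alt5_perm.
Qed.

(** * Conjugacy classes and the five points as transitive A5-sets *)

Definition class_ok (c : seq (seq nat)) :=
  [&& uniq c, all (mem S5) c,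
      all (fun t => all (fun u => tconj t u \in c) alt5) c &
      all (fun t => all (fun t' => has (fun u => tconj t u == t') alt5) c) c].

Lemma class15_ok : class_ok class15. Proof. by vm_compute. Qed.
Lemma class20_ok : class_ok class20. Proof. by vm_compute. Qed.
Lemma class12_ok : class_ok class12. Proof. by vm_compute. Qed.

Section ClassOrbit.
Variables (c : seq (seq nat)) (n : nat).
Hypotheses (c_ok : class_ok c) (sc : size c = n).

Lemma class_untabK t : t \in c -> tab (untab5 t) = t.
Proof. by case/and4P: c_ok => _ /allP cP _ _ /cP /untabK. Qed.

Lemma mem_class x : (x \in map untab5 c) = (tab x \in c).
Proof.
apply/mapP/idP => [[t tc ->]|xc]; first by rewrite class_untabK.
by exists (tab x); rewrite ?tabK.
Qed.

Lemma class_orbit : orbit_seq A5 'J (map untab5 c) n.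
Proof.
case/and4P: (c_ok) => Uc _ /allP cJ /allP cO; split.
- rewrite map_inj_in_uniq // => t u tc uc tu.
  by rewrite -(class_untabK tc) tu class_untabK.
- by rewrite size_map.
move=> x; rewrite mem_class => xc y; rewrite mem_class.
apply/orbitP/idP => [[g gA <-]|yc].
  by rewrite /= tabJ; apply: (allP (cJ _ xc)); rewrite A5_tab.
have /allP/(_ _ yc)/hasP[u uA /eqP uE] := cO _ xc.
exists (untab5 u); first exact: alt5_A5.
by apply: tab_inj; rewrite /= tabJ untabK ?alt5_perm.
Qed.

Lemma class_latE x :
  seq_lat 'J%act 1%g (map untab5 c) n x =
  mxf n n (fun i j => (tconj (nth [::] c i) (tab x) == nth [::] c j)%:R).
Proof.
apply/matrixP=> i j; rewrite !mxE -(inj_eq (@tab_inj 4)) /= tabJ.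
by rewrite !(nth_map [::]) ?sc // !class_untabK // mem_nth ?sc.
Qed.

End ClassOrbit.

Lemma points_orbit : orbit_seq A5 'P (enum 'I_5) 5.
Proof.
split; [exact: enum_uniq | exact: size_enum_ord | move=> i _ j].
rewrite mem_enum; apply/orbitP.
have ok : all (fun i => all (fun j => has (fun u => nth 0%N u i == j) alt5)
  (iota 0 5)) (iota 0 5) by vm_compute.
have [||u uA /eqP uE] := hasP (allP (allP ok i _) j _); rewrite ?mem_iota //=.
exists (untab5 u); first exact: alt5_A5.
by apply: val_inj; rewrite /= -nth_tab untabK ?alt5_perm.
Qed.

Lemma points_latE x :
  seq_lat 'P%act ord0 (enum 'I_5) 5 x =
  mxf 5 5 (fun i j => (nth 0%N (tab x) i == j)%:R).
Proof.
by apply/matrixP=> i j; rewrite !mxE !nth_ord_enum /= nth_tab.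
Qed.

Definition tab_id := [:: 0; 1; 2; 3; 4]%N.

Lemma tab_id_eq : tab (1 : {perm 'I_5}) = tab_id.
Proof. exact: tab1. Qed.

(** * Fixed points of subgroups of type V4, C5 and A4 *)

(** As [H] is abelian, it fixes each of its involutions under conjugation, and all involutions of A5
    lie in [class15]. *)
Lemma V4_stab (H : {group {perm 'I_5}}) :
  H \subset A5 -> (H \isog V4)%g ->
  exists2 x, x \in map untab5 class15 & forall k, k \in H -> ('J%act x k = x)%g.
Proof.
move=> HA; rewrite isog_sym => /isogP[f f_inj fH].
pose v : 'Z_2 * 'Z_2 := (1, 0).
have vV w : w \in V4 by rewrite inE.
have fMJ k : k \in H -> ('J%act (f v) k = f v)%g.
  rewrite -fH => /morphimP[w wV _ ->] /=; rewrite -morphJ //.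
  by congr (f _); apply/conjg_fixP/commgP; rewrite /commute; congr pair; exact: addrC.
exists (f v); last exact: fMJ.
have vA : f v \in A5 by rewrite (subsetP HA) // -fH mem_morphim.
have v2 : (f v * f v)%g = 1%g by rewrite -morphM // -[RHS](morph1 f); congr (f _); apply/eqP.
have v1 : f v != 1%g.
  by rewrite -(morph1 f) (inj_in_eq (injmP f_inj)) ?vV.
rewrite (mem_class class15_ok).
have ok : all (fun t => (tcomp t t == tab_id) ==> (t != tab_id) ==> (t \in class15)) alt5.
  by vm_compute.
have := allP ok _ (A5_tab vA); rewrite -tabM v2 tab_id_eq eqxx /=.
by rewrite -tab_id_eq (inj_eq (@tab_inj 4)) v1.
Qed.

(** A generator is centralised by [C]. Squaring exchanges the two classes of 5-cycles, so the
    generator or its square lies in [class12]. *)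
Lemma C5_stab (C : {group {perm 'I_5}}) :
  C \subset A5 -> (C \isog C5)%g ->
  exists2 x, x \in map untab5 class12 & forall k, k \in C -> ('J%act x k = x)%g.
Proof.
move=> CA; rewrite isog_sym => /isogP[f f_inj fC].
have vV w : w \in C5 by rewrite inE.
have fMJ v k : k \in C -> ('J%act (f v) k = f v)%g.
  rewrite -fC => /morphimP[w wV _ ->] /=; rewrite -morphJ //.
  by congr (f _); apply/conjg_fixP/commgP; exact: addrC.
pose c := f 1%R.
have cA : c \in A5 by rewrite (subsetP CA) // -fC mem_morphim.
have c5 : (c * (c * (c * (c * c))))%g = 1%g.
  by rewrite -!morphM // -[RHS](morph1 f); congr (f _); apply/eqP.
have c1 : c != 1%g.
  by rewrite -(morph1 f) (inj_in_eq (injmP f_inj)) ?vV.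
have ok : all (fun t => let t2 := tcomp t t in
    (tcomp t (tcomp t (tcomp t t2)) == tab_id) ==> (t != tab_id) ==>
    (t \in class12) || (t2 \in class12)) alt5 by vm_compute.
have := allP ok _ (A5_tab cA); rewrite /= -!tabM c5 tab_id_eq eqxx /=.
rewrite -tab_id_eq (inj_eq (@tab_inj 4)) c1 /= -!(mem_class class12_ok).
case/orP=> cc; first by exists c => // k kC; apply: fMJ.
by exists (c * c)%g => // k kC; rewrite /c -morphM //; apply: fMJ.
Qed.

(* A4 contains an involution commuting with all its conjugates; its unique
   fixed point in 'I_5 is therefore fixed by the whole subgroup. *)
Lemma A4_stab (A : {group {perm 'I_5}}) :
  A \subset A5 -> (A \isog A4)%g ->
  exists i : 'I_5, forall k, k \in A -> ('P%act i k = i)%g.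
Proof.
move=> AA; rewrite isog_sym => /isogP[f f_inj fA].
have S4 t : t \in permutations (iota 0 4) -> tab (untab 3 t) = t by apply: untabK.
pose a : {perm 'I_4} := untab 3 [:: 1; 0; 3; 2]%N.
have aA : a \in A4.
  (* The square root is a 4-cycle. *)
  by apply: (@untab_sqr_even _ _ [:: 2; 3; 1; 0]%N); vm_compute.
have ta : tab a = [:: 1; 0; 3; 2]%N by apply: S4; vm_compute.
have aJ g : commute a (a ^ g)%g.
  have ok : all (fun t => let b := tconj [:: 1; 0; 3; 2]%N t in
     tcomp [:: 1; 0; 3; 2]%N b == tcomp b [:: 1; 0; 3; 2]%N) (permutations (iota 0 4)).
    by vm_compute.
  apply: tab_inj; rewrite tabM [RHS]tabM tabJ ta; apply/eqP.
  exact: (allP ok _ (mem_tab g)).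
have faA : f a \in A5 by rewrite (subsetP AA) // -fA mem_morphim.
have fa2 : (f a * f a)%g = 1%g.
  rewrite -morphM // -[RHS](morph1 f); congr (f _).
  by apply: tab_inj; rewrite tabM ta tab1.
have fa1 : f a != 1%g.
  rewrite -(morph1 f) (inj_in_eq (injmP f_inj)) ?group1 //.
  by apply/eqP=> /(congr1 (@tab 3)); rewrite ta tab1.
(* An involution of A5 is a double transposition, so it fixes exactly one of the five points. *)
have ok : all (fun t => (tcomp t t == tab_id) ==> (t != tab_id) ==>
    has (fun i => (nth 0%N t i == i) &&
      all (fun j => (nth 0%N t j == j) ==> (j == i)) (iota 0 5)) (iota 0 5)) alt5.
  by vm_compute.
have := allP ok _ (A5_tab faA); rewrite -tabM fa2 tab_id_eq eqxx implyTb.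
rewrite -tab_id_eq (inj_eq (@tab_inj 4)) fa1 implyTb => /hasP[i].
rewrite mem_iota => lt_i /andP[/eqP fi /allP Ui].
pose p := Ordinal (lt_i : (i < 5)%N).
have fp : f a p = p by apply: val_inj; rewrite /= -nth_tab.
have Up q : f a q = q -> q = p.
  move=> fq; apply/val_inj/eqP; apply: (implyP (Ui q _)).
    by rewrite mem_iota /=.
  by rewrite nth_tab fq.
exists p => k; rewrite -fA => /morphimP[g gA _ ->] /=; rewrite /aperm.
have afg : (f a ^ f g)%g (f g p) = f g p.
  by rewrite conjgE !permM permK fp.
have cfg : commute (f a) (f a ^ f g)%g.
  by rewrite -morphJ // /commute -!morphM ?groupJ // aJ.
(* The conjugate commutes with [f a] and so preserves its only fixed point. Conjugating back, [f a]
   fixes the preimage of [p] under [f g], which must then be [p]. *)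
have bp : (f a ^ f g)%g p = p.
  by apply: Up; rewrite -permM -cfg permM fp.
have : f a ((f g)^-1%g p) = (f g)^-1%g p.
  by apply: (@perm_inj _ (f g)); rewrite permKV -[RHS]bp conjgE !permM.
by move/Up => {1}<-; rewrite permKV.
Qed.

(** * The explicit lattices *)

Section SplitTrivial.
Variables (gT : finGroupType) (G : {group gT}) (m n : nat).
Variables (Q : gT -> 'M[int]_m) (phi : 'cV[int]_m) (z : 'rV[int]_m).
Variables (U : 'M[int]_(n, m)) (V : 'M[int]_(m, n)).
Hypotheses (Q_repr : mx_repr G Q) (UV : U *m V = 1%:M).
Hypotheses (VU : V *m U = 1%:M - phi *m z).
Hypotheses (Uphi : U *m phi = 0) (zV : z *m V = 0) (zphi : z *m phi = 1%:M).
Hypothesis phiG : is_hom G Q (@triv_lat _) phi.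
Hypothesis zG : is_hom G (@triv_lat _) Q z.

(** The action of [Q] on ker phi: the rows of [U] are a basis of it, and [V] gives coordinates after
    projection along [z]. *)
Definition split_lat : gT -> 'M[int]_n := fun x => U *m Q x *m V.

(** The defect phi z Q(x) V vanishes, as [z] is invariant and z V = 0. In the next lemma the defect
    U Q(x) phi z vanishes dually, by invariance of [phi] and U phi = 0. *)
Lemma split_lat_proj : is_hom G Q split_lat V.
Proof.
move=> x xG; rewrite /split_lat !mulmxA VU mulmxBl mul1mx mulmxBl.
by rewrite -(mulmxA phi) -zG // !mulmxA -(mulmxA phi) mul1mx -mulmxA zV mulmx0 subr0.
Qed.

Lemma split_lat_inj : is_hom G split_lat Q U.
Proof.
move=> x xG; rewrite /split_lat -!mulmxA VU !mulmxBr mulmx1.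
by rewrite (mulmxA (Q x)) phiG // /triv_lat mulmx1 (mulmxA U phi) Uphi mul0mx subr0.
Qed.

Lemma split_lat_repr : mx_repr G split_lat.
Proof.
case: Q_repr => Q1 QM; split=> [|x y xG yG]; first by rewrite /split_lat Q1 mulmx1.
by rewrite {1}/split_lat QM // -!mulmxA split_lat_proj // !mulmxA.
Qed.

Lemma split_lat_iso : lattice_iso G Q (dsum (@triv_lat _) split_lat).
Proof.
exists (row_mx phi V), (col_mx z U); split=> [x xG||].
- rewrite /dsum mul_mx_row mul_row_block !mulmx0 addr0 add0r.
  by rewrite phiG // split_lat_proj.
- by rewrite mul_row_col VU addrC subrK.
- by rewrite mul_col_row zphi zV Uphi UV -scalar_mx_block.
Qed.

End SplitTrivial.

(** * Matrix arithmetic by evaluation *)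

Definition zsum n (f : nat -> int) := foldr (fun k s => f k + s) 0 (iota 0 n).

(** Big sums are locked against reduction, whereas the fold is evaluated by [vm_compute]. *)
Lemma zsumE n (f : nat -> int) : \sum_(k < n) f k = zsum n f.
Proof.
rewrite -(big_mkord xpredT f) /index_iota subn0 /zsum.
by elim: (iota 0 n) => [|k l IHl]; rewrite ?big_nil // big_cons IHl.
Qed.

Definition mulf n (f g : nat -> nat -> int) i j := zsum n (fun k => f i k * g k j).
Definition dsumf m (f g : nat -> nat -> int) i j :=
  if (i < m)%N then if (j < m)%N then f i j else 0
  else if (j < m)%N then 0 else g (i - m)%N (j - m)%N.
(** Tabulating first means that costly entries are looked up instead of being recomputed in every
    product. *)
Definition memo m n (f : nat -> nat -> int) :=
  let l := mkseq (fun i => mkseq (f i) n) m in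
  fun i j => nth 0 (nth [::] l i) j.
Definition eqf m n (f g : nat -> nat -> int) :=
  all (fun i => all (fun j => f i j == g i j) (iota 0 n)) (iota 0 m).
Definition idf i j : int := (i == j :> nat)%:R.
Definition subf (f g : nat -> nat -> int) i j := f i j - g i j.
Definition addf (f g : nat -> nat -> int) i j := f i j + g i j.

Lemma mxfM m n p f g : mxf m n f *m mxf n p g = mxf m p (mulf n f g).
Proof.
by apply/matrixP=> i j; rewrite !mxE /mulf -zsumE; apply: eq_bigr => k _; rewrite !mxE.
Qed.

Lemma mxfD m n f g : mxf m n f + mxf m n g = mxf m n (addf f g).
Proof. by apply/matrixP=> i j; rewrite !mxE. Qed.

Lemma mxfB m n f g : mxf m n f - mxf m n g = mxf m n (subf f g).
Proof. by apply/matrixP=> i j; rewrite !mxE. Qed.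

Lemma mxf1 n : 1%:M = mxf n n idf.
Proof. by apply/matrixP=> i j; rewrite !mxE. Qed.

Lemma mxf0 m n : 0 = mxf m n (fun _ _ => 0).
Proof. by apply/matrixP=> i j; rewrite !mxE. Qed.

Lemma mxf_const m n a : const_mx a = mxf m n (fun _ _ => a).
Proof. by apply/matrixP=> i j; rewrite !mxE. Qed.

Lemma mxf_block m n f g :
  block_mx (mxf m m f) 0 0 (mxf n n g) = mxf (m + n) (m + n) (dsumf m f g).
Proof.
apply/matrixP=> i j; rewrite !mxE /dsumf.
by case: splitP => i' ei; rewrite mxE; case: splitP => j' ej;
  rewrite !mxE ?ei ?ej ?addKn.
Qed.

Lemma eq_mxf m n f g : eqf m n f g -> mxf m n f = mxf m n g.
Proof.
move=> /allP fg; apply/matrixP=> i j; rewrite !mxE.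
have /allP/(_ j)/(_ _)/eqP : all (fun j => f i j == g i j) (iota 0 n).
  by apply: fg; rewrite mem_iota /=.
by apply; rewrite mem_iota /=.
Qed.

(** * The maps of the resolution in coordinates *)

Definition conjf c t i j : int := (tconj (nth [::] c i) t == nth [::] c j)%:R.
Definition pointf t i j : int := (nth 0%N t i == j)%:R.

(* The matrix of the G-map sending x0 to the sum of the orbit of y0 under the
   stabiliser of x0. *)
Definition orbf c d x0 y0 i j : int :=
  (has (fun u => (tconj x0 u == nth [::] c i) && (tconj y0 u == nth [::] d j))
    alt5)%:R.
Definition orbpf c x0 y0 i j : int :=
  (has (fun u => (tconj x0 u == nth [::] c i) && (nth 0%N u y0 == j)) alt5)%:R.

(* Base points for the involutions and the 3-cycles. The second entries of the
   pairs defining T_f and pi_f come from a computer search among the orbit sums. *)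
Definition x15 := [:: 0; 2; 1; 4; 3]%N.
Definition x20 := [:: 0; 1; 3; 4; 2]%N.

Definition P_f t := dsumf 20 (conjf class20 t) (conjf class15 t).
Definition Q_f t := dsumf 12 (conjf class12 t) (dsumf 5 (pointf t) (pointf t)).

(** Each block is a difference of two orbit sums of equal length, which makes the map vanish on the
    norm element. *)
Definition T_f := memo 15 35 (fun i j =>
  if (j < 20)%N then
    orbf class15 class20 x15 [:: 0; 1; 4; 2; 3]%N i j
    - orbf class15 class20 x15 [:: 1; 3; 2; 0; 4]%N i j
  else orbf class15 class15 x15 [:: 0; 3; 4; 1; 2]%N i (j - 20)%N
    - orbf class15 class15 x15 x15 i (j - 20)%N).

(** A 3-cycle goes to three 5-cycles plus a point of the first copy, an involution to four 5-cycles
    plus a point of the second. With the weights 1, -3, -4 both images lie in ker phi. *)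
Definition pi_f := memo 35 22 (fun i j =>
  if (i < 20)%N then
    if (j < 12)%N then orbf class20 class12 x20 tab5 i j
    else if (j < 17)%N then orbpf class20 x20 0%N i (j - 12)%N else 0
  else
    if (j < 12)%N then orbf class15 class12 x15 tab5 (i - 20)%N j
    else if (j < 17)%N then 0 else orbpf class15 x15 0%N (i - 20)%N (j - 17)%N).

(* With phi_0 = 1, the vectors e_i - phi_i e_0 (i > 0) are a basis U of ker phi,
   and V is the projection 1 - phi z written in this basis. *)
Definition phi_f i (_ : nat) : int :=
  if (i < 12)%N then 1 else if (i < 17)%N then -3 else -4.
Definition z_f (_ : nat) j : int := if (j < 12)%N then 3 else 1.

Definition U_f i j : int := idf i.+1 j - (j == 0%N)%:R * phi_f i.+1 0%N.
Definition V_f i j : int := idf i j.+1 - phi_f i 0%N * z_f 0%N j.+1.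

(* Found by integer linear algebra: a section of pi V : P -> F, and a retraction
   of T modulo the norm element. *)
Definition section_data : seq (seq int) := [::
  [:: 0; 0; 0; 1; 0; 0; 0; -1; 0; 0; 0; 0; 0; 0; 0; -1; 0; 1; 0; 0; -1; 0; 1; 1; 0; 0; 1; -1; 0; 0; -1; 0; 0; 0; 0];
  [:: 0; 0; 0; 0; 0; 1; 0; 0; 0; 0; 0; -1; 0; 0; 0; -1; 0; 0; 1; 0; 0; 0; 0; 1; 0; 0; 1; -1; 0; 0; -1; 0; 0; 0; 0];
  [:: 0; 0; -1; 0; 0; -1; 1; 0; 0; 0; 0; 0; 1; 0; 0; 0; 0; 0; 0; 0; 0; 1; -1; -1; -1; 1; 0; 0; 0; 1; 0; 0; 0; 0; 0];
  [:: 0; 0; 0; 0; 0; -1; 1; 0; 0; 1; -1; 0; 0; 0; 0; 0; 0; 0; 0; 0; -1; 1; 0; 0; -1; 1; 1; -1; 0; 1; -1; 0; 0; 0; 0];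
  [:: 0; 0; 0; 0; 0; 0; 0; 0; 0; 0; -1; 0; 0; 0; 0; -1; 1; 0; 1; 0; -1; 0; 1; 0; 1; 0; 1; 0; 0; 0; 0; -1; 0; -1; 0];
  [:: -1; 0; 0; 0; 0; 0; 1; 0; 0; 0; -1; 0; 0; 0; 0; 0; 0; 0; 1; 0; 0; 0; 0; 1; 0; -1; 1; 0; -1; 0; 0; 0; 1; -1; 0];
  [:: 1; 0; 0; 0; 0; -1; 0; 0; 1; 0; 0; 0; 1; 0; -1; 0; 0; 0; -1; 0; 0; 0; 0; -1; 0; 0; 0; 1; 0; 0; 0; 0; 0; 0; 0];
  [:: -1; 0; 0; 0; 1; 0; 0; 0; 0; 0; -1; 0; 0; -1; 0; 0; 1; 0; 1; 0; 0; 0; 0; 0; -1; 1; 0; -1; 0; 1; -1; 0; 0; 1; 0];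
  [:: -1; 0; 0; 0; 1; 0; 0; 0; 0; 0; 0; 0; 0; -1; 0; 1; 0; 0; 0; 0; 0; 0; 0; 0; -1; 0; 0; 0; -1; 1; 0; 0; 0; 0; 1];
  [:: 0; -1; -1; 1; 0; 0; 0; 0; 0; 0; 1; 0; 0; 0; 0; 0; 0; -1; 1; 0; 1; -1; 0; 0; 0; 0; 0; 0; 0; 0; 0; 0; -1; 0; 1];
  [:: 0; 1; 0; -1; 0; 0; 0; 0; 1; 0; 0; -1; 1; -1; 0; 0; 0; 0; 0; 0; 0; 0; 0; 0; 0; 0; 0; 0; 0; 0; -1; 0; 0; 1; 0];
  [:: 0; 1; 0; 0; -1; 0; 0; 0; 0; 0; 1; 1; -1; 1; 0; 1; 0; 0; -1; -1; 0; -1; 1; 0; 1; 0; 0; 0; 1; 0; 0; -1; -1; 0; 0];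
  [:: 0; 1; 0; -1; -1; 0; 0; 1; 0; 0; 0; 1; 0; 1; 0; 1; 0; 0; -1; -1; 1; -1; 0; 0; 0; -1; 0; 1; 0; 0; 0; 0; 0; 0; 0];
  [:: 0; 1; 1; -1; 0; 1; 0; 0; 0; 0; 0; 0; -1; 1; 0; 1; -1; 0; -1; 0; 0; 1; -1; 0; 0; 0; -1; 0; 0; 0; 1; 0; 1; 0; -1];
  [:: 0; 1; 1; -1; -1; 1; -1; 1; 0; 0; 0; 0; -1; 0; 1; 0; 0; 0; 0; 0; 1; -1; 0; 1; 0; -1; 0; 0; 0; -1; -1; 1; 0; 1; 0];
  [:: 0; 0; 1; -1; 0; 1; -1; 1; -1; 0; 0; 0; -1; 0; 1; 1; 0; 0; 0; 0; 0; 0; 0; 1; 0; -1; -1; 0; 0; -1; 1; 1; 1; 0; -1];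
  [:: 0; 0; 1; -1; 0; 1; -1; 1; -1; -1; 0; 1; -1; 1; 0; 1; 0; 0; -1; 0; 1; 0; -1; -1; 0; 0; -1; 1; 0; 1; 1; 0; 0; 0; 0];
  [:: 1; 1; 0; -1; -1; 1; 0; 0; 0; 0; 1; 0; -1; 1; 0; 1; -1; -1; -1; 0; 1; 0; -1; 0; 0; 0; 0; 0; 0; 0; 1; 0; 0; 0; 0];
  [:: 1; 0; 1; -1; -1; 1; -1; 1; 0; -1; 1; 0; 0; 1; 0; 0; -1; 0; -1; 0; 0; 0; 0; 1; 0; 0; 0; 0; 1; 0; 0; 0; 0; 0; -1];
  [:: 0; 1; 0; -1; -1; 1; -1; 1; 0; 0; 1; 0; -1; 0; 1; 1; 0; -1; 0; -1; 0; 1; 0; 1; 0; 0; -1; -1; 0; 0; 1; 0; 1; 0; -1];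
  [:: 0; 1; 0; -1; -1; 1; -1; 1; 0; 0; 1; 0; -1; 0; 1; 1; 0; -1; 0; -1; 1; -1; 0; 1; 0; -1; 0; 0; 0; 0; 0; 0; 0; 0; 1]]%Z.
Definition retraction_data : seq (seq int) := [::
  [:: -1; 1; 0; 1; -1; -1; 0; -1; 0; 0; -1; 0; 0; 0; -1];
  [:: 0; 0; 0; 0; 0; 0; 0; 0; 0; 0; -1; 0; 0; 0; 0];
  [:: -1; 0; 1; 0; 1; -1; 1; 0; 0; -1; -1; -1; 0; -1; 0];
  [:: 0; 0; 1; 1; 0; -1; 1; 1; 0; 0; -1; 1; 1; 1; 0];
  [:: 0; 1; -2; 0; -1; 0; 0; -2; 0; 1; -1; -1; 0; 0; -1];
  [:: 0; 0; 1; 0; 0; 0; 1; 1; 0; 1; 0; 0; 1; 1; 1];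
  [:: -1; 1; 1; 1; 0; 0; 1; -1; 0; 1; -1; -1; 0; 1; 1];
  [:: 0; 0; 0; 1; -1; -1; 0; -1; -1; 1; -2; 0; 0; 1; 0];
  [:: 0; 0; -1; -1; -1; 0; -1; -1; -1; 1; 0; -1; 0; 0; -1];
  [:: 1; -1; 1; 1; 0; 0; 0; 0; 0; 1; -1; 0; 0; 1; 1];
  [:: 0; -1; 0; 0; 0; 0; 0; -1; 0; 0; -1; -1; -1; 0; 1];
  [:: 0; 0; -1; -1; -1; 0; 0; -1; 0; 1; -1; -1; 0; 0; 0];
  [:: 0; 0; 1; 0; 1; -1; 1; 1; 0; 0; -1; 0; 1; 0; 0];
  [:: 0; 0; 0; 0; 1; 0; 0; 0; 0; 0; 0; 0; 0; 0; 0];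
  [:: 0; 1; 0; 1; 0; -1; 1; 0; 0; 0; 0; 0; 1; 0; -1];
  [:: 0; 0; 0; 0; 0; -1; 0; 1; 0; 0; 0; 1; 1; 0; -1];
  [:: -1; -1; 0; -1; 0; 0; -1; -1; 0; 0; -1; -1; -1; 1; 0];
  [:: 0; 0; 0; 1; -1; -1; -1; -1; -1; 1; -1; 0; 0; 0; -1];
  [:: 0; 0; 0; 0; 0; 0; 0; 0; 0; 0; 0; 0; 0; -1; 0];
  [:: 1; -1; 1; 1; 0; 0; -1; 0; 0; 1; -1; 1; 0; 2; 1];
  [:: 0; 1; 0; 2; 0; -1; 0; -1; 0; 1; -1; 0; 1; 0; -1];
  [:: 0; 1; -1; 0; 0; 1; 0; -1; 1; 2; 0; 0; 1; 1; 0];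
  [:: -1; 0; 0; 1; 0; -1; 0; -1; -1; 0; -1; -1; 0; -1; 0];
  [:: 0; 1; 0; 1; 0; 1; 0; -1; 1; 2; -1; 0; 0; 2; 0];
  [:: 1; 1; 0; 1; 0; 0; 1; 0; 0; 2; -1; 0; 1; 1; 0];
  [:: -1; 0; 0; 1; 0; -2; 1; 0; -1; 0; -2; -1; 0; -1; -1];
  [:: 1; 0; -1; 0; 0; 0; 1; 0; 0; 1; 0; 0; 1; 0; 0];
  [:: 0; 0; 0; 1; 0; 1; 1; 0; 1; 1; 0; 0; 0; 1; 1];
  [:: 1; 0; 0; 0; 0; 1; 0; 0; 0; 2; 0; 0; 1; 1; 1];
  [:: 1; 0; 1; 1; 0; 1; 0; 0; 0; 1; 0; 0; 0; 1; 1];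
  [:: 0; 0; 0; 0; 0; 0; 0; -1; -1; 1; -1; -1; 0; 0; 0];
  [:: 0; 0; -1; -2; 0; 1; 0; 0; -1; 1; 0; -2; 0; -1; 0];
  [:: 0; -1; 1; 2; 0; -2; 1; 0; -1; 0; -2; 0; 0; 0; 1];
  [:: 0; 0; 0; 1; 0; 0; 1; -1; 0; 1; -1; 0; 0; 1; 1];
  [:: -1; 0; 0; 0; 0; -1; 0; -1; -1; 1; -2; -1; 0; 0; 0]]%Z.

Definition s_f i j := nth 0 (nth [::] section_data i) j.
Definition R_f i j := nth 0 (nth [::] retraction_data i) j.
Definition piV_f := memo 35 21 (mulf 22 pi_f V_f).
Definition TR_f := memo 15 15 (mulf 35 T_f R_f).

(** * Matrix identities checked by computation *)

Notation Pdim := (20 + 15)%N.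
Notation Qdim := (12 + (5 + 5))%N.

Lemma T_ones : const_mx 1 *m mxf 15 Pdim T_f = 0 :> 'rV_Pdim.
Proof. rewrite mxf_const mxfM mxf0; apply: eq_mxf; vm_compute; reflexivity. Qed.

Lemma T_hom t : t \in [:: tab5; tab3] ->
  mxf 15 15 (conjf class15 t) *m mxf 15 Pdim T_f =
  mxf 15 Pdim T_f *m mxf Pdim Pdim (P_f t).
Proof.
rewrite !mxfM => tP; apply: eq_mxf; move: tP; rewrite !inE.
by case/orP=> /eqP->; vm_compute.
Qed.

Lemma pi_hom t : t \in [:: tab5; tab3] ->
  mxf Pdim Pdim (P_f t) *m mxf Pdim Qdim pi_f =
  mxf Pdim Qdim pi_f *m mxf Qdim Qdim (Q_f t).
Proof.
rewrite !mxfM => tP; apply: eq_mxf; move: tP; rewrite !inE.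
by case/orP=> /eqP->; vm_compute.
Qed.

Lemma phi_hom t : t \in [:: tab5; tab3] ->
  mxf Qdim Qdim (Q_f t) *m mxf Qdim 1 phi_f = mxf Qdim 1 phi_f.
Proof.
rewrite !mxfM => tP; apply: eq_mxf; move: tP; rewrite !inE.
by case/orP=> /eqP->; vm_compute.
Qed.

Lemma z_hom t : t \in [:: tab5; tab3] ->
  mxf 1 Qdim z_f *m mxf Qdim Qdim (Q_f t) = mxf 1 Qdim z_f.
Proof.
rewrite !mxfM => tP; apply: eq_mxf; move: tP; rewrite !inE.
by case/orP=> /eqP->; vm_compute.
Qed.

Lemma UV : mxf 21 Qdim U_f *m mxf Qdim 21 V_f = 1%:M.
Proof. by rewrite mxfM mxf1; apply: eq_mxf; vm_compute. Qed.

Lemma VU :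
  mxf Qdim 21 V_f *m mxf 21 Qdim U_f = 1%:M - mxf Qdim 1 phi_f *m mxf 1 Qdim z_f.
Proof. by rewrite !mxfM mxf1 mxfB; apply: eq_mxf; vm_compute. Qed.

Lemma Uphi : mxf 21 Qdim U_f *m mxf Qdim 1 phi_f = 0.
Proof. by rewrite mxfM mxf0; apply: eq_mxf; vm_compute. Qed.

Lemma zV : mxf 1 Qdim z_f *m mxf Qdim 21 V_f = 0.
Proof. by rewrite mxfM mxf0; apply: eq_mxf; vm_compute. Qed.

Lemma zphi : mxf 1 Qdim z_f *m mxf Qdim 1 phi_f = 1%:M.
Proof. by rewrite mxfM mxf1; apply: eq_mxf; vm_compute. Qed.

Lemma piV : mxf Pdim Qdim pi_f *m mxf Qdim 21 V_f = mxf Pdim 21 piV_f.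
Proof. by rewrite mxfM; apply: eq_mxf; vm_compute. Qed.

Lemma T_pi : mxf 15 Pdim T_f *m mxf Pdim 21 piV_f = 0.
Proof. by rewrite mxfM mxf0; apply: eq_mxf; vm_compute. Qed.

Lemma s_pi : mxf 21 Pdim s_f *m mxf Pdim 21 piV_f = 1%:M.
Proof. by rewrite mxfM mxf1; apply: eq_mxf; vm_compute. Qed.

Lemma RT_pis :
  mxf Pdim 15 R_f *m mxf 15 Pdim T_f + mxf Pdim 21 piV_f *m mxf 21 Pdim s_f = 1%:M.
Proof. by rewrite !mxfM mxfD mxf1; apply: eq_mxf; vm_compute. Qed.

(** All columns of 1 - T R coincide, so the vector [k] of [chevalley_short_exact] is read off from
    column 0. *)
Lemma TR :
  mxf 15 Pdim T_f *m mxf Pdim 15 R_f =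
  1%:M - mxf 15 1 (fun i _ => idf i 0%N - TR_f i 0%N) *m const_mx 1.
Proof. by rewrite mxf_const !mxfM mxf1 mxfB; apply: eq_mxf; vm_compute. Qed.

(** * The A5-lattices P, Q and F *)

Definition lat15 := seq_lat 'J%act 1%g (map untab5 class15) 15.
Definition lat20 := seq_lat 'J%act 1%g (map untab5 class20) 20.
Definition lat12 := seq_lat 'J%act 1%g (map untab5 class12) 12.
Definition lat5 := seq_lat 'P%act (ord0 : 'I_5) (enum 'I_5) 5.
Definition latP := dsum lat20 lat15.
Definition latQ := dsum lat12 (dsum lat5 lat5).

Lemma orbit15 : orbit_seq A5 'J (map untab5 class15) 15.
Proof. by apply: class_orbit; [exact: class15_ok | vm_compute]. Qed.
Lemma orbit20 : orbit_seq A5 'J (map untab5 class20) 20.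
Proof. by apply: class_orbit; [exact: class20_ok | vm_compute]. Qed.
Lemma orbit12 : orbit_seq A5 'J (map untab5 class12) 12.
Proof. by apply: class_orbit; [exact: class12_ok | vm_compute]. Qed.

Lemma lat15E x : lat15 x = mxf 15 15 (conjf class15 (tab x)).
Proof. by apply: class_latE; [exact: class15_ok | vm_compute]. Qed.

Lemma latPE x : latP x = mxf Pdim Pdim (P_f (tab x)).
Proof.
rewrite /latP /dsum -mxf_block; congr block_mx; last exact: lat15E.
by apply: class_latE; [exact: class20_ok | vm_compute].
Qed.

Lemma latQE x : latQ x = mxf Qdim Qdim (Q_f (tab x)).
Proof.
rewrite /latQ /dsum -mxf_block -mxf_block; congr block_mx.
  by apply: class_latE; [exact: class12_ok | vm_compute].
by congr block_mx; apply: points_latE.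
Qed.

Lemma lat15_repr : mx_repr A5 lat15.
Proof. exact: seq_lat_repr orbit15. Qed.

Lemma latP_repr : mx_repr A5 latP.
Proof. exact: dsum_repr (seq_lat_repr _ orbit20) lat15_repr. Qed.

Lemma latQ_repr : mx_repr A5 latQ.
Proof.
apply: dsum_repr (seq_lat_repr _ orbit12) _.
exact: dsum_repr (seq_lat_repr _ points_orbit) (seq_lat_repr _ points_orbit).
Qed.

Lemma triv_repr : mx_repr A5 (@triv_lat {perm 'I_5}).
Proof. by split=> [|x y _ _]; rewrite /triv_lat ?mulmx1. Qed.

Lemma A5_hom m n (r : {perm 'I_5} -> 'M[int]_m) (s : {perm 'I_5} -> 'M[int]_n) f :
  mx_repr A5 r -> mx_repr A5 s ->
  (forall x, tab x \in [:: tab5; tab3] -> r x *m f = f *m s x) ->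
  is_hom A5 r s f.
Proof.
move=> r_repr s_repr h; apply: (is_hom_gen A5_gen) => // x /set2P[]->; apply: h.
  by rewrite untabK //; vm_compute.
by rewrite untabK //; vm_compute.
Qed.

Definition latF := split_lat latQ (mxf 21 Qdim U_f) (mxf Qdim 21 V_f).

Lemma phi_inv : is_hom A5 latQ (@triv_lat _) (mxf Qdim 1 phi_f).
Proof.
apply: A5_hom latQ_repr triv_repr _ => x xt.
by rewrite latQE phi_hom // mulmx1.
Qed.

Lemma z_inv : is_hom A5 (@triv_lat _) latQ (mxf 1 Qdim z_f).
Proof.
apply: A5_hom triv_repr latQ_repr _ => x xt.
by rewrite latQE z_hom // mul1mx.
Qed.

Lemma latF_repr : mx_repr A5 latF.
Proof. exact: (split_lat_repr latQ_repr UV VU zV z_inv). Qed.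

Lemma latQ_iso : lattice_iso A5 latQ (dsum (@triv_lat _) latF).
Proof. exact: (split_lat_iso UV VU Uphi zV zphi phi_inv z_inv). Qed.

Lemma latF_flabby : flabby A5 latF.
Proof.
move=> K KA.
have sub m n (r : {perm 'I_5} -> 'M[int]_m) (s : {perm 'I_5} -> 'M[int]_n) f :
    is_hom A5 r s f -> is_hom K r s f by move=> h x /(subsetP KA); apply: h.
apply: (tate_summand (sub _ _ _ _ _ (split_lat_inj VU Uphi phi_inv))
  (sub _ _ _ _ _ (split_lat_proj VU zV z_inv)) UV).
apply: tate_dsum; first exact: (seq_lat_tate orbit12 KA).
by apply: tate_dsum; exact: (seq_lat_tate points_orbit KA).
Qed.

Lemma latP_permutation : is_permutation A5 latP.
Proof.
have x20P : untab5 x20 \in map untab5 class20 by rewrite map_f //; vm_compute.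
have x15P : untab5 x15 \in map untab5 class15 by rewrite map_f //; vm_compute.
apply: is_permutation_iso (lattice_iso_sym (lattice_iso_dsum
  (lattice_iso_stab 1%g orbit20 x20P) (lattice_iso_stab 1%g orbit15 x15P))) _.
apply: is_permutation_dsum; first exact: subsetIl.
apply: is_permutation_perm_lat; exact: subsetIl.
Qed.

(** The trivial lattice comes from the one-point orbit of the identity under conjugation. *)
Lemma triv_permutation : is_permutation A5 (@triv_lat {perm 'I_5}).
Proof.
have O1 : orbit_seq A5 'J [:: 1%g : {perm 'I_5}] 1.
  split=> // x; rewrite inE => /eqP-> y; rewrite inE.
  by apply/orbitP/eqP => [[g _ <-] | ->]; [|exists 1%g] => /=; rewrite ?conj1g.
apply: (@is_permutation_iso _ _ _ _ _ (seq_lat 'J%act 1%g [:: 1%g] 1)).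
  exists 1%:M, 1%:M; split; rewrite ?mulmx1 // => x _.
  rewrite /triv_lat mulmx1 mul1mx; apply/matrixP=> i j.
  by rewrite !mxE !ord1 /= conj1g eqxx.
apply: is_permutation_iso (lattice_iso_sym (lattice_iso_stab 1%g O1 (mem_head _ _))) _.
apply: is_permutation_perm_lat; exact: subsetIl.
Qed.

Theorem theorem1p3 (H C A : {group {perm 'I_5}}) :
  H \subset A5 -> (H \isog V4)%g ->
  C \subset A5 -> (C \isog C5)%g ->
  A \subset A5 -> (A \isog A4)%g ->
  exists (p : nat) (rP : {perm 'I_5} -> 'M[int]_p) (rF : {perm 'I_5} -> 'M[int]_21)
         (i : 'M[int]_(#|rcosets H A5|.-1, p)) (pi : 'M[int]_(p, 21)),
    [/\ flabby_resolution A5 (chevalley_lat A5 H) rP rF i pi,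
        lattice_iso A5 (dsum (perm_lat A5 C) (dsum (perm_lat A5 A) (perm_lat A5 A)))
                       (dsum (@triv_lat _) rF)
      & stably_permutation A5 rF].
Proof.
move=> HA HV CA CC AA AI.
have [h hP hH] := V4_stab HA HV; have [c cP cC] := C5_stab CA CC.
have [a aA] := A4_stab AA AI.
(* The orders 4, 5 and 12 pair with orbits of length 15, 12 and 5 to give 60, so the three subgroups
   are full stabilisers. *)
have cardH : (#|H| * 15 = #|A5|)%N.
  by rewrite (card_isog HV) cardsT card_prod card_ord card_A5.
have cardC : (#|C| * 12 = #|A5|)%N.
  by rewrite (card_isog CC) cardsT card_ord card_A5.
have cardA : (#|A| * 5 = #|A5|)%N.
  have := @card_Alt 'I_4; rewrite card_ord => /(_ isT) e.
  rewrite (card_isog AI) card_A5.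
  by apply/eqP; rewrite -(eqn_pmul2l (isT : 0 < 2)%N) mulnA [(2 * _)%N]e.
have [f [g [hf fg gf f1]]] := perm_lat_orbit 1%g orbit15 hP HA hH cardH.
have isoC := lattice_iso_orbit 1%g orbit12 cP CA cC cardC.
have aP : a \in enum 'I_5 by rewrite mem_enum.
have isoA := lattice_iso_orbit ord0 points_orbit aP AA aA cardA.
have isoQ : lattice_iso A5
    (dsum (perm_lat A5 C) (dsum (perm_lat A5 A) (perm_lat A5 A)))
    (dsum (@triv_lat _) latF).
  apply: lattice_iso_trans latQ_iso.
  by apply: lattice_iso_dsum isoC _; apply: lattice_iso_dsum.
(* The injection lifts J to Z[A5/H], relabels cosets as involutions and applies T; the surjection is
   pi followed by the projection of Q onto F. *)
exists Pdim, latP, latF, (chev_sect _ *m f *m mxf 15 Pdim T_f), (mxf Pdim 21 piV_f).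
split=> //.
- split; [exact: latP_repr | exact: latF_repr | | exact: latP_permutation
         | exact: latF_flabby].
  apply: (chevalley_short_exact hf fg gf f1 _ T_ones TR _ T_pi s_pi RT_pis).
    by apply: A5_hom lat15_repr latP_repr _ => x xt; rewrite lat15E latPE T_hom.
  have pi_inv : is_hom A5 latP latQ (mxf Pdim Qdim pi_f).
    by apply: A5_hom latP_repr latQ_repr _ => x xt; rewrite latPE latQE pi_hom.
  move=> x xA; rewrite -piV mulmxA pi_inv // -!mulmxA.
  by rewrite (split_lat_proj VU zV z_inv).
(* Adding one trivial summand to F already gives the permutation lattice Q. *)
- exists _, (@triv_lat _), _, (dsum (perm_lat A5 C) (dsum (perm_lat A5 A) (perm_lat A5 A))).
  split; first exact: triv_permutation.
    by do 2!apply: is_permutation_dsum => //; apply: is_permutation_perm_lat.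
  exact: lattice_iso_trans (lattice_iso_dsumC _ _ _) (lattice_iso_sym isoQ).
Qed.
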